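(* Let $\mathcal{L}=\{L_0,\dots,L_{15}\}$ be the set of the 16 lines of the $D_4$ configuration in $\mathbb{P}^3_{\mathbb{C}}$, and let $(\mathcal{L},\Pi)$ be the groupoid whose objects are the lines in $\mathcal{L}$ and whose morphisms are all compositions of projection maps $\pi(L,L',L'')$ with $L,L',L''\in\mathcal{L}$ and $L\cap L'=L'\cap L''=\varnothing$. Then the group of this groupoid is isomorphic to the symmetric group $S_3$; that is, for every $L\in\mathcal{L}$, $\mathrm{Aut}_{(\mathcal{L},\Pi)}(L)\cong S_3$.
   Context: Projection maps: for lines $L,L',L''\subseteq\mathbb{P}^3_{\mathbb{C}}$ with $L\cap L'=L'\cap L''=\varnothing$ (it is allowed that $L\cap L''\neq\varnothing$), the isomorphism $\pi(L,L',L''):L\to L''$ sends a point $P\in L$ to the unique point of $L''\cap H$, where $H$ is the unique plane containing $P$ and $L'$. Given a set $\mathcal{L}$ of lines, $\Pi$ is the set of all compositions of finite composable sequences of maps $\pi(L,L',L'')$ with $L,L',L''\in\mathcal{L}$, $L\cap L'=L'\cap L''=\varnothing$. A morphism from $A$ to $B$ ($A,B\in\mathcal{L}$) is an element of $\Pi$ that is a map $A\to B$, and $\mathrm{Aut}_{(\mathcal{L},\Pi)}(L)$ is the group of all elements of $\Pi$ that are maps $L\to L$. A groupoid is regular if the automorphism groups of all its objects are isomorphic; in this case their common isomorphism class is called the group of the groupoid. The 16 lines of the $D_4$ configuration: put $p_0=(0,0,0,1)$, $p_1=(1,1,0,1)$, $p_2=(1,0,1,1)$, $p_3=(0,1,1,1)$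 and $q_0=(0,0,1,0)$, $q_1=(0,1,0,0)$, $q_2=(1,0,0,0)$, $q_3=(1,1,1,2)$. Then for $0\le a,b\le 3$, $L_{4a+b}$ is the line in $\mathbb{P}^3_{\mathbb{C}}$ spanned by $p_a$ and $q_b$. *)

(* Defs.v *)
From HB Require Import structures.
From mathcomp Require Import all_boot all_order all_algebra all_fingroup.
From mathcomp Require Import boolp classical_sets reals complex.

Set Implicit Arguments.
Unset Strict Implicit.
Unset Printing Implicit Defensive.

Import GRing.Theory.
Local Open Scope ring_scope.

Record groupoid := Groupoid {
  gobj : Type;
  ghom : gobj -> gobj -> Type;
  gid : forall x, ghom x x;
  gcomp : forall x y z, ghom y z -> ghom x y -> ghom x z;
  ginv : forall x y, ghom x y -> ghom y x;
  gcompA : forall x y z t (h : ghom z t) (g : ghom y z) (f : ghom x y),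
    gcomp h (gcomp g f) = gcomp (gcomp h g) f;
  gcomp1m : forall x y (f : ghom x y), gcomp (gid y) f = f;
  gcompm1 : forall x y (f : ghom x y), gcomp f (gid x) = f;
  gcompVm : forall x y (f : ghom x y), gcomp (ginv f) f = gid x;
  gcompmV : forall x y (f : ghom x y), gcomp f (ginv f) = gid y
}.

Definition gaut (G : groupoid) (x : gobj G) : Type := ghom x x.

HB.instance Definition _ (G : groupoid) (x : gobj G) := gen_eqMixin (gaut x).
HB.instance Definition _ (G : groupoid) (x : gobj G) :=
  gen_choiceMixin (gaut x).
HB.instance Definition _ (G : groupoid) (x : gobj G) :=
  @isGroup.Build (gaut x) (@gid G x) (@ginv G x x) (@gcomp G x x x)
    (@gcompA G x x x x) (@gcomp1m G x x) (@gcompm1 G x x)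
    (@gcompVm G x x) (@gcompmV G x x).

Definition group_iso (A B : groupType) : Prop :=
  exists f : {multiplicative A -> B}, bijective f.

Definition regular (G : groupoid) : Prop :=
  forall x y : gobj G, group_iso (gaut x) (gaut y).

(* The group of a regular groupoid is an isomorphism class: has_group G A says
   that it is the class of A. *)
Definition has_group (G : groupoid) (A : groupType) : Prop :=
  regular G /\ forall x : gobj G, group_iso (gaut x) A.

Section ProjectiveSpace.
Variable F : fieldType.

(* A d-dimensional linear subspace of P^3(F), as a (d+1)-dimensional vector
   subspace of F^4. *)
Record psubspace (d : nat) := PSubspace {
  psubspace_val :> {vspace 'rV[F]_4};
  _ : \dim psubspace_val == d.+1
}.

HB.instance Definition _ d := [isSub for @psubspace_val d].
HB.instance Definition _ d := [Choice of psubspace d by <:].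

Definition point := psubspace 0.
Definition line := psubspace 1.
Definition plane := psubspace 2.

(* Disjointness in P^3 is trivial intersection in F^4. *)
Definition skew (L L' : line) : bool := (L :&: L' == 0)%VS.

Definition points_on (L : line) := {P : point | (P <= L)%VS}.

Lemma dim_psubspace d (V : psubspace d) : \dim V = d.+1.
Proof. exact: eqP (valP V). Qed.

Lemma skew_sym (L L' : line) : skew L L' -> skew L' L.
Proof. by rewrite /skew capvC. Qed.

Lemma point_capv0 (P : point) (L : line) :
  ~~ (P <= L)%VS -> (P :&: L = 0)%VS.
Proof.
move=> PL; apply/eqP; rewrite -dimv_eq0 -leqn0 -ltnS.
have := dimvS (capvSl P L); rewrite (dim_psubspace P) => leP.
rewrite ltn_neqAle leP andbT; apply: contra PL => /eqP e.
suff <- : (P :&: L)%VS = P by apply: capvSr.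
by apply/eqP; rewrite eqEdim capvSl e (dim_psubspace P).
Qed.

Lemma span_plane_dim (P : point) (L : line) :
  ~~ (P <= L)%VS -> \dim (P + L)%VS == 3%N.
Proof.
move=> /point_capv0 PL; have := dimv_sum_cap P L.
by rewrite PL dimv0 addn0 !dim_psubspace => ->.
Qed.

Definition span_plane (P : point) (L : line) (PL : ~~ (P <= L)%VS) : plane :=
  PSubspace (span_plane_dim PL).

Lemma span_plane_unique (P : point) (L : line) (PL : ~~ (P <= L)%VS)
  (H : plane) : (P <= H)%VS -> (L <= H)%VS -> H = span_plane PL.
Proof.
move=> PH LH; apply/val_inj/esym/eqP => /=.
rewrite eqEdim subv_add PH LH /= (eqP (span_plane_dim PL)).
by rewrite (dim_psubspace H).
Qed.

Lemma meet_point_dim (L : line) (H : plane) :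
  ~~ (L <= H)%VS -> \dim (L :&: H)%VS == 1%N.
Proof.
move=> LH.
have ltH : (3 < \dim (L + H))%N.
  have := dimvS (addvSr L H); rewrite (dim_psubspace H) => leH.
  rewrite ltn_neqAle leH andbT; apply: contra LH => /eqP e.
  suff -> : psubspace_val H = (L + H)%VS by apply: addvSl.
  by apply/eqP; rewrite eqEdim addvSr -e (dim_psubspace H).
have leH : (\dim (L + H) <= 4)%N.
  by have := dimvS (subvf (L + H)); rewrite dimvf /dim /= mul1n.
have := dimv_sum_cap L H; rewrite !dim_psubspace.
have -> : \dim (L + H) = 4 by apply/eqP; rewrite eqn_leq leH ltH.
by rewrite -[(2 + 3)%N]/(4 + 1)%N => /addnI ->.
Qed.

Definition meet_point (L : line) (H : plane) (LH : ~~ (L <= H)%VS) : point :=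
  PSubspace (meet_point_dim LH).

Lemma meet_point_unique (L : line) (H : plane) (LH : ~~ (L <= H)%VS)
  (Q : point) : (Q <= L)%VS -> (Q <= H)%VS -> Q = meet_point LH.
Proof.
move=> QL QH; apply/val_inj/eqP => /=.
by rewrite eqEdim subv_cap QL QH (eqP (meet_point_dim LH)) (dim_psubspace Q).
Qed.

Lemma point_on_skew (L L' : line) (P : points_on L) :
  skew L L' -> ~~ (sval P <= L')%VS.
Proof.
case: P => P PL /= /eqP LL'; apply/negP => PL'.
have : (P <= L :&: L')%VS by rewrite subv_cap PL.
by rewrite LL' subv0 -dimv_eq0 dim_psubspace.
Qed.

Lemma skew_not_in_span (L' L'' : line) (P : point) (PL' : ~~ (P <= L')%VS) :
  skew L' L'' -> ~~ (L'' <= span_plane PL')%VS.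
Proof.
move=> /eqP L'L''; apply/negP => /= sL''.
have : (L' + L'' <= P + L')%VS by rewrite subv_add addvSr.
move/dimvS; rewrite (eqP (span_plane_dim PL')).
have := dimv_sum_cap L' L''.
by rewrite L'L'' dimv0 addn0 !dim_psubspace => ->.
Qed.

Definition proj_map (L L' L'' : line) (LL' : skew L L') (L'L'' : skew L' L'')
    (P : points_on L) : points_on L'' :=
  exist _ (meet_point (skew_not_in_span (point_on_skew P LL') L'L''))
    (capvSl _ _).

(* Compositions of finite composable sequences of projection maps between
   lines of S. The empty sequence is allowed, so that identities exist for
   every S; it adds nothing at a line L for which S has some L' skew to L, as
   then the identity of L is the projection map from L to L through L'. *)
Inductive composite (S : set line) :
    forall L M : line, (points_on L -> points_on M) -> Prop :=
| Composite_nil L : S L -> composite S (@id (points_on L))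
| Composite_cons L L' L'' M (LL' : skew L L') (L'L'' : skew L' L'')
    (f : points_on L'' -> points_on M) :
    S L -> S L' -> S L'' -> composite S f ->
    composite S (f \o proj_map LL' L'L'').

Lemma composite_comp S (L M N : line) (g : points_on M -> points_on N)
    (f : points_on L -> points_on M) :
  composite S g -> composite S f -> composite S (g \o f).
Proof.
move=> Sg Sf; elim: Sf g Sg => // K L' L'' P KL' L'L'' h SK SL' SL'' _ IH g Sg.
exact: (Composite_cons KL' L'L'' SK SL' SL'' (IH g Sg)).
Qed.

Lemma proj_mapK (L L' L'' : line) (LL' : skew L L') (L'L'' : skew L' L'')
    (L''L' : skew L'' L') (L'L : skew L' L) :
  cancel (proj_map LL' L'L'') (proj_map L''L' L'L).
Proof.
move=> P; apply/val_inj/esym/meet_point_unique; first exact: (svalP P).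
set Q := proj_map LL' L'L'' P.
have <- : span_plane (point_on_skew P LL') = span_plane (point_on_skew Q L''L').
  by apply: span_plane_unique; [apply: capvSr | apply: addvSr].
exact: addvSl.
Qed.

Lemma composite_inv S (L M : line) (f : points_on L -> points_on M) :
  composite S f -> exists2 g, composite S g & cancel f g /\ cancel g f.
Proof.
elim=> [K SK|K L' L'' N KL' L'L'' h SK SL' SL'' _ [g Sg [hK gK]]].
  by exists id; [exact: Composite_nil | split].
have Sp := Composite_cons (skew_sym L'L'') (skew_sym KL') SL'' SL' SK
  (Composite_nil SK).
exists (proj_map (skew_sym L'L'') (skew_sym KL') \o g).
  exact: composite_comp Sp Sg.
by split; apply: can_comp => //; apply: proj_mapK.
Qed.

Section ProjectionGroupoid.
Variable S : set line.

Definition pobj := {L : line | S L}.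

Definition phom (L M : pobj) :=
  {f : points_on (sval L) -> points_on (sval M) | composite S f}.

Lemma phom_inj (L M : pobj) (f g : phom L M) : sval f = sval g -> f = g.
Proof. by move: f g => [f Sf] [g Sg] /= e; apply: eq_exist. Qed.

Definition pid (L : pobj) : phom L L := exist _ id (Composite_nil (svalP L)).

Definition pcomp (L M N : pobj) (g : phom M N) (f : phom L M) : phom L N :=
  exist _ (sval g \o sval f) (composite_comp (svalP g) (svalP f)).

Definition pinv_sig (L M : pobj) (f : phom L M) :
  {g : phom M L | cancel (sval f) (sval g) /\ cancel (sval g) (sval f)}.
Proof.
by apply: cid; case: (composite_inv (svalP f)) => g Sg fg; exists (exist _ g Sg).
Qed.

Definition pinv (L M : pobj) (f : phom L M) : phom M L := sval (pinv_sig f).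

Lemma pcompVm (L M : pobj) (f : phom L M) : pcomp (pinv f) f = pid L.
Proof. by apply/phom_inj/funext => P; apply: (svalP (pinv_sig f)).1. Qed.

Lemma pcompmV (L M : pobj) (f : phom L M) : pcomp f (pinv f) = pid M.
Proof. by apply/phom_inj/funext => P; apply: (svalP (pinv_sig f)).2. Qed.

Lemma pcompA (L M N O : pobj) (h : phom N O) (g : phom M N) (f : phom L M) :
  pcomp h (pcomp g f) = pcomp (pcomp h g) f.
Proof. exact: phom_inj. Qed.

Lemma pcomp1m (L M : pobj) (f : phom L M) : pcomp (pid M) f = f.
Proof. exact: phom_inj. Qed.

Lemma pcompm1 (L M : pobj) (f : phom L M) : pcomp f (pid L) = f.
Proof. exact: phom_inj. Qed.

Definition projection_groupoid : groupoid :=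
  Groupoid pcompA pcomp1m pcompm1 pcompVm pcompmV.

End ProjectionGroupoid.

Definition coords (x y z w : F) : 'rV[F]_4 := \row_i [:: x; y; z; w]`_i.

Definition D4_p (a : 'I_4) : 'rV[F]_4 :=
  [:: coords 0 0 0 1; coords 1 1 0 1; coords 1 0 1 1; coords 0 1 1 1]`_a.

Definition D4_q (b : 'I_4) : 'rV[F]_4 :=
  [:: coords 0 0 1 0; coords 0 1 0 0; coords 1 0 0 0; coords 1 1 1 2%:R]`_b.

Lemma coordsE x y z w :
  (coords x y z w 0 0 = x) * (coords x y z w 0 1 = y) *
  (coords x y z w 0 2%:R = z) * (coords x y z w 0 3%:R = w).
Proof. by rewrite !mxE. Qed.

Lemma D4_line_dim (a b : 'I_4) : \dim (<[D4_p a]> + <[D4_q b]>)%VS == 2%N.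
Proof.
have p0 : D4_p a != 0.
  apply/eqP => /rowP/(_ 3%:R)/eqP; rewrite [X in _ == X]mxE.
  by case: a => [[|[|[|[|//]]]] ?]; rewrite /D4_p /= coordsE oner_eq0.
have q0 : D4_q b \notin <[D4_p a]>%VS.
  apply/negP => /vlineP[c e].
  have ei i : D4_q b 0 i = c * D4_p a 0 i by rewrite e mxE.
  move: (ei 0) (ei 1) (ei 2%:R) (ei 3%:R) => {ei e p0}.
  case: b => [[|[|[|[|//]]]] ?]; case: a => [[|[|[|[|//]]]] ?];
    rewrite /D4_p /D4_q /= !coordsE ?mulr1 ?mulr0 => e0 e1 e2 e3;
    move: (oner_eq0 F); try by [rewrite e0 eqxx | rewrite e1 eqxx | rewrite e2 eqxx].
  all: try by rewrite e0 -e3 eqxx.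
  all: try by rewrite e1 -e3 eqxx.
  all: try by rewrite e2 -e3 eqxx.
have qn0 : D4_q b != 0 by apply: contraNneq q0 => ->; rewrite mem0v.
have dis : (<[D4_p a]> :&: <[D4_q b]> = 0)%VS.
  apply/eqP; rewrite -subv0; apply/subvP => v; rewrite memv_cap memv0.
  case/andP => vp /vlineP[c vq]; apply: contraNT q0 => v0.
  have c0 : c != 0 by apply: contra_neq v0 => c0; rewrite vq c0 scale0r.
  by rewrite -[D4_q b](scalerK c0) -vq memvZ.
by rewrite dimv_disjoint_sum // !dim_vline p0 qn0.
Qed.

Definition D4_line (a b : 'I_4) : line := PSubspace (D4_line_dim a b).

Definition D4_lines : set line :=
  [set L | exists a b : 'I_4, L = D4_line a b]%classic.

End ProjectiveSpace.

(* Main.v *)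
(** Besides a point p_a and a point q_b, every line of the configuration carries
    a third marked point, one of the four points r_0, ..., r_3.  The 12 points
    p_a, q_b, r_c lie by sixes on 12 planes, and whenever L, L', L'' are lines of
    the configuration with L' skew to L and L'', the plane through L' and a
    marked point of L is one of them and contains a marked point of L''.  Hence
    every morphism L -> M permutes the three colours p, q, r of the marked
    points.  It is induced by a linear map, so it is determined by its values at
    three points, and Aut(L) embeds into S_3.  Loops of three projections at one
    line realize all transpositions, and the groupoid is connected. *)

From HB Require Import structures.
From mathcomp Require Import all_boot all_algebra all_fingroup.
From mathcomp Require Import boolp classical_sets reals complex.
Require Import Defs.

Set Implicit Arguments.
Unset Strict Implicit.
Unset Printing Implicit Defensive.

Import GRing.Theory Num.Theory.
Local Open Scope ring_scope.

(** * Isomorphisms of groups *)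

Lemma group_iso_bij (A B : groupType) (f : A -> B) :
  {morph f : x y / (x * y)%g} -> bijective f -> group_iso A B.
Proof.
move=> fM fbij; pose m := isMultiplicative.Build A B f fM.
by exists (HB.pack_for {multiplicative A -> B} f m).
Qed.

Lemma group_iso_sym (A B : groupType) : group_iso A B -> group_iso B A.
Proof.
case=> f [g fK gK]; apply: (@group_iso_bij _ _ g); last by exists f.
by move=> x y; apply: (can_inj fK); rewrite gmulfM !gK.
Qed.

Lemma group_iso_trans (A B C : groupType) :
  group_iso A B -> group_iso B C -> group_iso A C.
Proof.
case=> f fbij [g gbij]; apply: (@group_iso_bij _ _ (g \o f)).
  by move=> x y /=; rewrite !gmulfM.
exact: bij_comp.
Qed.

Lemma has_group_iso (G : groupoid) (A : groupType) :
  (forall x : gobj G, group_iso (gaut x) A) -> has_group G A.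
Proof.
move=> isoA; split=> // x y.
exact: group_iso_trans (isoA x) (group_iso_sym (isoA y)).
Qed.

(** * Projections as linear maps, and rigidity on three points *)

Section Projectivities.
Variable F : fieldType.
Implicit Types (L M : line F) (P Q : point F) (phi : 'End('rV[F]_4)).

Lemma point_line P : exists2 v : 'rV[F]_4, v != 0 & (P = <[v]> :> {vspace _})%VS.
Proof.
have P0 : (P != 0 :> {vspace _})%VS by rewrite -dimv_eq0 dim_psubspace.
exists (vpick P); first by rewrite vpick0.
apply/esym/eqP; rewrite eqEdim -memvE memv_pick dim_psubspace dim_vline.
by rewrite vpick0 P0.
Qed.

Lemma eq_point P Q : (P <= Q)%VS -> P = Q.
Proof. by move=> PQ; apply/val_inj/eqP; rewrite eqEdim PQ !dim_psubspace. Qed.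

Lemma point_disjoint P Q : P != Q -> (P :&: Q = 0)%VS.
Proof.
move=> PQ; apply/eqP; rewrite -dimv_eq0 -leqn0 -ltnS.
have := dimvS (capvSl P Q); rewrite (dim_psubspace P) => leP.
rewrite ltn_neqAle leP andbT; apply: contra PQ => /eqP e.
apply/eqP/eq_point; suff <- : (P :&: Q)%VS = P by apply: capvSr.
by apply/eqP; rewrite eqEdim capvSl e (dim_psubspace P).
Qed.

Lemma eq_points_on L (P Q : points_on L) : sval P = sval Q -> P = Q.
Proof. by case: P Q => [P PL] [Q QL] /= e; apply: eq_exist. Qed.

(** Evaluates a projection from any plane known to satisfy the incidences, since such a plane must
    be the span of [P] and [L']. *)
Lemma proj_map_plane L L' L'' (LL' : skew L L') (L'L'' : skew L' L'')
    (P : points_on L) (Q : points_on L'') (H : plane F) :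
  (sval P <= H)%VS -> (L' <= H)%VS -> (sval Q <= H)%VS ->
  proj_map LL' L'L'' P = Q.
Proof.
move=> PH L'H QH; apply/eq_points_on/esym/meet_point_unique; first exact: (svalP Q).
by rewrite -(span_plane_unique (point_on_skew P LL') PH L'H).
Qed.

(** Take for [phi] the projection onto [L''] along [L'] in the direct sum of [L''] and [L']. It
    changes a vector of [P] by a vector of [L'], so the image stays in the plane spanned by [P] and
    [L']. *)
Lemma projection_linear L L' L'' (LL' : skew L L') (L'L'' : skew L' L'') :
  exists phi, forall P : points_on L,
    (sval (proj_map LL' L'L'' P) = phi @: sval P :> {vspace _})%VS.
Proof.
have dis : (L'' :&: L' = 0)%VS by rewrite capvC; apply/eqP.
have sumf : (L'' + L' = fullv)%VS.
  by apply/eqP; rewrite eqEdim subvf dimv_disjoint_sum // !dim_psubspace dimvf.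
exists (daddv_pi L'' L') => P.
have [v v0 Pv] := point_line (sval P).
have vP : v \in psubspace_val (sval P) by rewrite Pv memv_line.
have vE : daddv_pi L'' L' v + daddv_pi L' L'' v = v.
  by apply: daddv_pi_add; rewrite ?sumf ?memvf.
apply/esym/eqP; rewrite eqEdim Pv limg_line dim_psubspace dim_vline -memvE.
rewrite [(_ < _)%N]lt0b memv_cap memv_pi /=; apply/andP; split.
  rewrite -[X in X \in _](addrK (daddv_pi L' L'' v)) vE.
  by rewrite memv_add // memvN memv_pi.
(* The image is nonzero, since otherwise [v] would lie in both [P] and [L']. *)
apply: contra_neq v0 => w0; apply/eqP; rewrite -memv0.
have <- : (sval P :&: L' = 0)%VS by apply: point_capv0; apply: point_on_skew LL'.
by rewrite memv_cap vP -vE w0 add0r memv_pi.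
Qed.

Lemma composite_linear (S : set (line F)) L M (f : points_on L -> points_on M) :
  composite S f ->
  exists phi, forall P : points_on L, (sval (f P) = phi @: sval P :> {vspace _})%VS.
Proof.
elim=> [K SK|K L' L'' N KL' L'L'' h SK SL' SL'' _ [phi hE]].
  by exists \1%VF => P; rewrite lim1g.
have [psi pE] := projection_linear KL' L'L''.
by exists (phi \o psi)%VF => P; rewrite limg_comp -pE -hE.
Qed.

(** Fixed points are spanned by eigenvectors. A third eigenvector with both coordinates nonzero in
    the basis of the first two forces all eigenvalues to agree, so [phi] is a nonzero scalar on
    [L]. *)
Lemma linear_fix_line phi L (P0 P1 P2 : points_on L) :
  P0 != P1 -> P0 != P2 -> P1 != P2 ->
  (phi @: sval P0 = sval P0 :> {vspace _})%VS ->
  (phi @: sval P1 = sval P1 :> {vspace _})%VS ->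
  (phi @: sval P2 = sval P2 :> {vspace _})%VS ->
  forall P : points_on L, (phi @: sval P = sval P :> {vspace _})%VS.
Proof.
move=> P01 P02 P12 fix0 fix1 fix2.
have neq (P Q : points_on L) : P != Q -> sval P != sval Q.
  by apply: contra_neq; apply: eq_points_on.
have [u u0 Pu] := point_line (sval P0).
have [v v0 Pv] := point_line (sval P1).
have [w w0 Pw] := point_line (sval P2).
have dis := point_disjoint (neq _ _ P01).
have LE : (sval P0 + sval P1 = L)%VS.
  apply/eqP; rewrite eqEdim subv_add (svalP P0) (svalP P1) dimv_disjoint_sum //.
  by rewrite !dim_psubspace.
have scal x P : (phi @: P = P :> {vspace _})%VS -> P = <[x]>%VS :> {vspace _} ->
    exists c, phi x = c *: x.
  move=> e ex; apply/vlineP; rewrite -ex -e.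
  by apply: memv_img; rewrite ex memv_line.
have [a ua] := scal _ _ fix0 Pu.
have [b vb] := scal _ _ fix1 Pv.
have [c wc] := scal _ _ fix2 Pw.
have : w \in psubspace_val L.
  by rewrite memvE -Pw; apply: (svalP P2).
rewrite -{1}LE => /memv_addP[x]; rewrite {1}Pu => /vlineP[s ->{x}].
case=> y; rewrite {1}Pv => /vlineP[t ->{y}] wE.
have s0 : s != 0.
  apply: contra_neq w0 => s0; apply/eqP; rewrite -memv0.
  rewrite -(point_disjoint (neq _ _ P12)) memv_cap Pw memv_line andbT.
  by rewrite wE s0 scale0r add0r Pv memvZ ?memv_line.
have t0 : t != 0.
  apply: contra_neq w0 => t0; apply/eqP; rewrite -memv0.
  rewrite -(point_disjoint (neq _ _ P02)) memv_cap Pw memv_line andbT.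
  by rewrite wE t0 scale0r addr0 Pu memvZ ?memv_line.
(* Compare [phi w] with [c *: w]. Both sides then lie in [P0] and in [P1], hence vanish. *)
have e : ((a - c) * s) *: u = ((c - b) * t) *: v.
  have := wc; rewrite wE linearD !linearZ /= ua vb.
  rewrite scalerDr !scalerA => e.
  apply/eqP; rewrite -subr_eq0 -scaleNr -mulNr opprB !mulrBl !scalerBl.
  rewrite addrACA -opprD [a * s]mulrC [b * t]mulrC [c * t]mulrC [c * s]mulrC.
  rewrite subr_eq0; move/eqP: e => /=.
  by rewrite [c * s]mulrC [c * t]mulrC.
have e0 : ((a - c) * s) *: u = 0.
  apply/eqP; rewrite -memv0 -dis memv_cap {2}e Pu Pv.
  by rewrite !memvZ ?memv_line.
have ac : a = c.
  apply/eqP; rewrite -subr_eq0; move/eqP: e0.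
  by rewrite scaler_eq0 (negPf u0) orbF mulf_eq0 (negPf s0) orbF.
have bc : b = c.
  apply/eqP; rewrite eq_sym -subr_eq0; move/eqP: e; rewrite e0 eq_sym.
  by rewrite scaler_eq0 (negPf v0) orbF mulf_eq0 (negPf t0) orbF.
(* With [c = 0] the image of [P2] would be zero instead of [P2]. *)
have c0 : c != 0.
  have := dim_psubspace (sval P2); rewrite -fix2 Pw limg_line wc.
  rewrite dim_vline; apply: contra_eq_neq => ->.
  by rewrite scale0r eqxx.
move=> P; have [x x0 Px] := point_line (sval P).
have phix : phi x = c *: x.
  have : x \in psubspace_val L by rewrite memvE -Px; apply: (svalP P).
  rewrite -{1}LE => /memv_addP[x1]; rewrite {1}Pu => /vlineP[p ->{x1}].
  case=> y; rewrite {1}Pv => /vlineP[q ->{y}] ->.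
  by rewrite linearD !linearZ /= ua vb ac bc scalerDr !scalerA ![c * _]mulrC.
apply/eqP; rewrite Px limg_line phix eqEdim -memvE memvZ ?memv_line //=.
by rewrite !dim_vline scaler_eq0 negb_or c0 x0.
Qed.

Lemma composite_inj (S : set (line F)) L M (f g : points_on L -> points_on M)
    (P0 P1 P2 : points_on L) :
  composite S f -> composite S g -> P0 != P1 -> P0 != P2 -> P1 != P2 ->
  f P0 = g P0 -> f P1 = g P1 -> f P2 = g P2 -> f =1 g.
Proof.
move=> Sf Sg P01 P02 P12 f0 f1 f2 P.
(* The composite of [f] with the inverse [h] of [g] fixes the three points, hence all of [L]. *)
have [h Sh [gK hK]] := composite_inv Sg.
have [phi hfE] := composite_linear (composite_comp Sh Sf).
apply: (can_inj hK); rewrite gK; apply/val_inj/val_inj => /=.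
rewrite [LHS]hfE; apply: (linear_fix_line P01 P02 P12).
- by rewrite -hfE /= f0 gK.
- by rewrite -hfE /= f1 gK.
- by rewrite -hfE /= f2 gK.
Qed.

End Projectivities.

(** * Incidence data *)

(* Colours 0, 1, 2 stand for the points p_a, q_b, r_c. *)
Definition D4_root (k : 'I_3) (i : 'I_4) : seq int :=
  nth [::] (nth [::]
    [:: [:: [:: 0; 0; 0; 1]; [:: 1; 1; 0; 1]; [:: 1; 0; 1; 1]; [:: 0; 1; 1; 1]];
        [:: [:: 0; 0; 1; 0]; [:: 0; 1; 0; 0]; [:: 1; 0; 0; 0]; [:: 1; 1; 1; 2]];
        [:: [:: 0; 0; 1; 1]; [:: 0; 1; 0; 1]; [:: 1; 0; 0; 1]; [:: 1; 1; 1; 1]]]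
    k) i.

(* The planes, given by linear forms, that contain six of the 12 points. *)
Definition D4_planes : seq (seq int) :=
  [:: [:: 0; 0; 1; -1]; [:: 0; 0; 1; 0]; [:: 0; 1; -1; 0]; [:: 0; 1; 0; -1];
      [:: 0; 1; 0; 0]; [:: 0; 1; 1; -1]; [:: 1; -1; 0; 0]; [:: 1; 0; -1; 0];
      [:: 1; 0; 0; -1]; [:: 1; 0; 0; 0]; [:: 1; 0; 1; -1]; [:: 1; 1; 0; -1]].

(* Explicit lists, because the enumeration of an ordinal type does not reduce
   under vm_compute. *)
Definition colors : seq 'I_3 :=
  [:: @Ordinal 3 0 isT; @Ordinal 3 1 isT; @Ordinal 3 2 isT].

Definition indices : seq 'I_4 :=
  [:: @Ordinal 4 0 isT; @Ordinal 4 1 isT; @Ordinal 4 2 isT; @Ordinal 4 3 isT].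

Definition labels : seq ('I_4 * 'I_4) := [seq (a, b) | a <- indices, b <- indices].

(* r_c lies on the line through p_a and q_b exactly when c is this index. *)
Definition third_index (a b : 'I_4) : 'I_4 :=
  nth ord0 indices (nth 0%N (nth [::]
    [:: [:: 0; 1; 2; 3]; [:: 3; 2; 1; 0]; [:: 2; 3; 0; 1]; [:: 1; 0; 3; 2]]%N a) b).

Definition mark_index (l : 'I_4 * 'I_4) (k : 'I_3) : 'I_4 :=
  nth ord0 [:: l.1; l.2; third_index l.1 l.2] k.

(** Integer coordinates make incidence computable; [root_vec_incident] carries it over to [F]. *)
Definition dotz (h x : seq int) : int :=
  h`_0 * x`_0 + h`_1 * x`_1 + h`_2 * x`_2 + h`_3 * x`_3.

Definition incident (h : seq int) (k : 'I_3) (i : 'I_4) : bool :=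
  dotz h (D4_root k i) == 0.

Definition contains (h : seq int) (l : 'I_4 * 'I_4) : bool :=
  all (fun k => incident h k (mark_index l k)) colors.

(** Combinatorial form of skewness: two lines of the configuration are disjoint exactly when they
    share no marked point, by [skew_label_skew] and [label_skew_skew]. *)
Definition label_skew (l m : 'I_4 * 'I_4) : bool :=
  all (fun k => mark_index l k != mark_index m k) colors.

(* The projection from line l to line n through m maps the marked point of
   colour k to the one of colour j. *)
Definition sends (l m n : 'I_4 * 'I_4) (k j : 'I_3) : bool :=
  has (fun h => [&& incident h k (mark_index l k), contains h m
                  & incident h j (mark_index n j)]) D4_planes.

(** * Finite checks on the incidence tables *)

Lemma mem_colors k : k \in colors.
Proof. by case: k => [[|[|[|[]]]] ?]; rewrite // !inE -!val_eqE. Qed.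

Lemma mem_indices i : i \in indices.
Proof. by case: i => [[|[|[|[|[]]]]] ?]; rewrite // !inE -!val_eqE. Qed.

Lemma mem_labels l : l \in labels.
Proof. by case: l => a b; apply: allpairs_f; apply: mem_indices. Qed.

Lemma all_colors (p : pred 'I_3) : all p colors -> forall k, p k.
Proof. by move=> /allP pP k; apply/pP/mem_colors. Qed.

Lemma all_indices (p : pred 'I_4) : all p indices -> forall i, p i.
Proof. by move=> /allP pP i; apply/pP/mem_indices. Qed.

Lemma all_labels (p : pred ('I_4 * 'I_4)) : all p labels -> forall l, p l.
Proof. by move=> /allP pP l; apply/pP/mem_labels. Qed.

(** Shows that the linear form is nonzero, so that its kernel is a plane. *)
Lemma plane_avoids (h : seq int) : h \in D4_planes ->
  has (fun i => ~~ incident h 0 i) indices.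
Proof. by move: h; apply/allP; vm_compute. Qed.

Lemma roots_separated (k k' : 'I_3) (i i' : 'I_4) : k != k' ->
  has (fun h => incident h k i && ~~ incident h k' i') D4_planes.
Proof.
apply/implyP; move: i'; apply: all_indices; move: i; apply: all_indices.
move: k'; apply: all_colors; move: k; apply: all_colors.
by vm_compute.
Qed.

Lemma lines_separated (l m : 'I_4 * 'I_4) : l != m ->
  has (fun h => contains h l && ~~ contains h m) D4_planes.
Proof.
apply/implyP; move: m; apply: all_labels; move: l; apply: all_labels.
by vm_compute.
Qed.

(** Such a plane through [l] meets [m] only in the marked point of colour [k]. Two of them, for
    different [k], force [l] and [m] to be disjoint. *)
Lemma label_skew_planes (l m : 'I_4 * 'I_4) (k j : 'I_3) :
  label_skew l m -> k != j ->
  has (fun h => [&& contains h l, incident h k (mark_index m k)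
                  & ~~ incident h j (mark_index m j)]) D4_planes.
Proof.
move=> lm; apply/implyP; move: lm; apply/implyP.
move: j; apply: all_colors; move: k; apply: all_colors.
move: m; apply: all_labels; move: l; apply: all_labels.
by vm_compute.
Qed.

Lemma sends_exists (l m n : 'I_4 * 'I_4) (k : 'I_3) :
  label_skew l m -> label_skew m n -> has (sends l m n k) colors.
Proof.
move=> lm mn.
(* The filters restrict the enumeration to triples whose consecutive lines are skew. *)
have /allP/(_ _ (mem_labels l))/allP/(_ m) : all (fun l => all (fun m =>
    all (fun n => all (fun k => has (sends l m n k) colors) colors)
      [seq n <- labels | label_skew m n])
    [seq m <- labels | label_skew l m]) labels by vm_compute.
rewrite mem_filter lm mem_labels => /(_ isT)/allP/(_ n).
by rewrite mem_filter mn mem_labels => /(_ isT)/all_colors.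
Qed.

(** Gives connectedness: a single projection joins any two lines. *)
Lemma label_skew_common (l n : 'I_4 * 'I_4) :
  has (fun m => label_skew l m && label_skew m n) labels.
Proof.
move: n; apply: all_labels; move: l; apply: all_labels.
by vm_compute.
Qed.

(** Writes the vector of [r_c] as a signed sum of those of [p_a] and [q_b], which puts it on their
    line. *)
Lemma third_root (l : 'I_4 * 'I_4) :
  has (fun st : int * int => all (fun j => (D4_root 2 (mark_index l 2))`_j ==
     st.1 * (D4_root 0 l.1)`_j + st.2 * (D4_root 1 l.2)`_j) (iota 0 4))
   [:: (1, 1); (1, -1); (-1, 1)].
Proof.
move: l; apply: all_labels.
by vm_compute.
Qed.

(** The loop goes from [l] to [n], [u] and back to [l], through [m], [o] and [w]. The nested
    conditional is [tperm i j] written out for computation. *)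
Lemma transposition_loop (i j : 'I_3) : i != j ->
  let l := (@Ordinal 4 0 isT, @Ordinal 4 0 isT) in
  exists m n o u w,
    [/\ [&& label_skew l m, label_skew m n & label_skew n o],
        [&& label_skew o u, label_skew u w & label_skew w l]
      & forall k, exists k1 k2, [/\ sends l m n k k1, sends n o u k1 k2
          & sends u w l k2 (if k == i then j else if k == j then i else k)]].
Proof.
move=> ij l; pose lab a b := (nth ord0 indices a, nth ord0 indices b).
(* Each tuple in the list is one loop; there is one for each of the three transpositions. *)
have /implyP/(_ ij)/hasP[[[[[m n] o] u] w] _ /and3P[lmno ouwl /allP sE]] :
  (i != j) ==> has (fun p => let: (m, n, o, u, w) := p in
    [&& [&& label_skew l m, label_skew m n & label_skew n o],
        [&& label_skew o u, label_skew u w & label_skew w l]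
      & all (fun k => has (fun k1 => has (fun k2 =>
          [&& sends l m n k k1, sends n o u k1 k2
            & sends u w l k2 (if k == i then j else if k == j then i else k)])
          colors) colors) colors])
    [:: (lab 1 1, lab 0 3, lab 2 2, lab 1 0, lab 2 3);
        (lab 1 1, lab 0 3, lab 2 0, lab 1 2, lab 2 1);
        (lab 1 1, lab 0 3, lab 2 0, lab 0 1, lab 3 2)]%N.
  clear ij; move: j; apply: all_colors; move: i; apply: all_colors.
  by vm_compute.
exists m, n, o, u, w; split=> // k.
have /hasP[k1 _ /hasP[k2 _ /and3P[e1 e2 e3]]] := sE _ (mem_colors k).
by exists k1, k2.
Qed.

(** * Transfer of the incidence tables to the geometry over [F] *)

Section D4Lines.
Variable F : numFieldType.
Local Notation S := (@D4_lines F).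

Definition root_vec (k : 'I_3) (i : 'I_4) : 'rV[F]_4 :=
  \row_j ((D4_root k i)`_j)%:~R.

Definition plane_form (h : seq int) : 'Hom('rV[F]_4, 'rV[F]_1) :=
  linfun (mulmxr (\col_(j < 4) (h`_j)%:~R)).

Definition plane_space (h : seq int) : {vspace 'rV[F]_4} := lker (plane_form h).

Lemma root_vec_incident (h : seq int) (k : 'I_3) (i : 'I_4) :
  (root_vec k i \in plane_space h) = incident h k i.
Proof.
(* Characteristic zero: an integer vanishes in [F] only if it is zero. *)
have -> : incident h k i = ((dotz h (D4_root k i))%:~R == 0 :> F).
  by rewrite intr_eq0.
rewrite memv_ker lfunE /=; set A := _ *m _.
have -> : (dotz h (D4_root k i))%:~R = A 0 0.
  rewrite mxE !big_ord_recl big_ord0 !mxE /= addr0.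
  by rewrite /dotz !intrD !intrM !addrA; congr (_ + _ + _ + _); rewrite mulrC.
apply/eqP/eqP => [->|A0]; first by rewrite mxE.
by apply/matrixP => a b; rewrite !ord1 A0 mxE.
Qed.

Lemma root_vec_neq0 (k : 'I_3) (i : 'I_4) : root_vec k i != 0.
Proof.
(* A zero vector would lie in every plane; [ordS k] merely supplies a different colour. *)
have /hasP[h _ /andP[_ hk]] :
    has (fun h => incident h (ordS k) i && ~~ incident h k i) D4_planes.
  by apply: roots_separated; move: k; apply: all_colors.
apply: contraNneq hk => v0.
by rewrite -root_vec_incident v0 mem0v.
Qed.

Lemma root_point_dim (k : 'I_3) (i : 'I_4) : \dim <[root_vec k i]>%VS == 1%N.
Proof. by rewrite dim_vline root_vec_neq0. Qed.

Definition root_point (k : 'I_3) (i : 'I_4) : point F :=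
  PSubspace (root_point_dim k i).

Lemma root_point_incident h (k : 'I_3) (i : 'I_4) :
  (root_point k i <= plane_space h)%VS = incident h k i.
Proof. by rewrite -memvE root_vec_incident. Qed.

Lemma D4_pE (a : 'I_4) : D4_p F a = root_vec 0 a.
Proof.
apply/rowP => j; rewrite !mxE.
by case: a => [[|[|[|[|[]]]]] ?] //; rewrite !mxE; case: j => [[|[|[|[|[]]]]] ?].
Qed.

Lemma D4_qE (b : 'I_4) : D4_q F b = root_vec 1 b.
Proof.
apply/rowP => j; rewrite !mxE.
by case: b => [[|[|[|[|[]]]]] ?] //; rewrite !mxE; case: j => [[|[|[|[|[]]]]] ?].
Qed.

Lemma D4_lineE l :
  D4_line F l.1 l.2 = (<[root_vec 0%R l.1]> + <[root_vec 1%R l.2]>)%VS :> {vspace _}.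
Proof. by rewrite -D4_pE -D4_qE. Qed.

Lemma root_point_on l k : (root_point k (mark_index l k) <= D4_line F l.1 l.2)%VS.
Proof.
rewrite -memvE D4_lineE; have := mem_colors k.
rewrite !inE => /or3P[]/eqP->.
- rewrite (_ : Ordinal _ = 0); last exact: val_inj.
  exact: (subvP (addvSl _ _) _ (memv_line _)).
- rewrite (_ : Ordinal _ = 1); last exact: val_inj.
  exact: (subvP (addvSr _ _) _ (memv_line _)).
rewrite (_ : Ordinal _ = 2); last exact: val_inj.
have /hasP[[s t] _ /allP stE] := third_root l.
have -> : root_vec 2 (mark_index l 2) =
    s%:~R *: root_vec 0 l.1 + t%:~R *: root_vec 1 l.2.
  apply/rowP => j; rewrite !mxE -!intrM -intrD; congr (_ %:~R).
  by apply/eqP; apply: stE; rewrite mem_iota ltn_ord.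
by rewrite memv_add // memvZ // memv_line.
Qed.

Lemma D4_line_contains h l :
  (D4_line F l.1 l.2 <= plane_space h)%VS = contains h l.
Proof.
apply/idP/idP => [lh|/allP hl].
  apply/allP => k _; rewrite -root_point_incident.
  exact: subv_trans (root_point_on l k) lh.
rewrite D4_lineE subv_add -!memvE !root_vec_incident.
by rewrite (hl 0 (mem_colors _)) (hl 1 (mem_colors _)).
Qed.

Lemma D4_line_inj l m : D4_line F l.1 l.2 = D4_line F m.1 m.2 -> l = m.
Proof.
move=> e; apply/eqP/negPn/negP => /lines_separated/hasP[h _].
by rewrite -!D4_line_contains e; case: (_ <= _)%VS.
Qed.

Lemma skew_label_skew l m :
  skew (D4_line F l.1 l.2) (D4_line F m.1 m.2) -> label_skew l m.
Proof.
move=> /eqP lm; apply/allP => k _; apply/eqP => e.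
have := root_vec_neq0 k (mark_index l k); rewrite -memv0 -lm memv_cap !memvE.
by rewrite root_point_on e root_point_on.
Qed.

Lemma label_skew_skew l m :
  label_skew l m -> skew (D4_line F l.1 l.2) (D4_line F m.1 m.2).
Proof.
move=> lm; rewrite /skew -subv0; apply/subvP => v.
rewrite memv_cap => /andP[vl]; rewrite D4_lineE => /memv_addP[x /vlineP[s ->]].
case=> y /vlineP[t ->] vE.
have vh h : contains h l -> v \in plane_space h.
  by rewrite -D4_line_contains => /subvP/(_ _ vl).
(* The plane [h] contains the [p] point of [m] but not its [q] point, and [g] the reverse.
   Membership of [v] in [h] kills [t], and in [g] kills [s]. *)
have /hasP[h _ /and3P[/vh hv]] := label_skew_planes lm (isT : 0 != 1 :> 'I_3).
have /hasP[g _ /and3P[/vh gv]] := label_skew_planes lm (isT : 1 != 0 :> 'I_3).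
rewrite -!root_vec_incident /= => g1 g0 h0 h1.
have zero c w (U : {vspace 'rV[F]_4}) : w \notin U -> c *: w \in U -> c = 0.
  move=> wU cw; apply: contraNeq wU => c0.
  by rewrite -(scalerK c0 w) memvZ.
have t0 : t = 0.
  apply: (zero _ _ (plane_space h) h1).
  rewrite -(addKr (s *: root_vec 0 m.1) (_ *: _)).
  by rewrite -vE memvD ?memvN ?memvZ.
have s0 : s = 0.
  apply: (zero _ _ (plane_space g) g0).
  rewrite -(addrK (t *: root_vec 1 m.2) (_ *: _)).
  by rewrite -vE memvB ?memvZ.
by rewrite vE s0 t0 !scale0r addr0 mem0v.
Qed.

(** A nonzero form has rank one, so rank-nullity gives a kernel of dimension three. *)
Lemma plane_space_dim h k i : ~~ incident h k i -> \dim (plane_space h) == 3%N.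
Proof.
rewrite -root_vec_incident => ni.
have := limg_ker_dim (plane_form h) fullv.
rewrite capfv dimvf /dim /= mul1n -/(plane_space h).
suff -> : \dim (plane_form h @: fullv) = 1%N by rewrite addn1 => -[->].
apply/eqP; rewrite eqn_leq; apply/andP; split.
  by apply: leq_trans (dimvS (subvf _)) _; rewrite dimvf.
rewrite lt0n dimv_eq0; apply: contra ni => /eqP e.
by rewrite memv_ker -memv0 -e memv_img ?memvf.
Qed.
End D4Lines.

(** * The groupoid *)

Section D4Groupoid.
Variable F : numFieldType.
Local Notation S := (@D4_lines F).
Implicit Types (L M N : pobj S) (k : 'I_3) (s : 'S_3).

(** Membership in the configuration is a mere existence statement, so the label is chosen
    classically; [D4_line_inj] makes it unique. *)
Lemma label_sig L : {l | sval L = D4_line F l.1 l.2}.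
Proof. by apply: cid; have [a [b e]] := svalP L; exists (a, b). Qed.

Definition label L : 'I_4 * 'I_4 := sval (label_sig L).

Lemma labelE L : sval L = D4_line F (label L).1 (label L).2.
Proof. exact: (svalP (label_sig L)). Qed.

Lemma label_line_subproof (l : 'I_4 * 'I_4) : S (D4_line F l.1 l.2).
Proof. by exists l.1, l.2. Qed.

Definition label_line (l : 'I_4 * 'I_4) : pobj S :=
  exist _ _ (label_line_subproof l).

Lemma label_lineK : cancel label_line label.
Proof. by move=> l; apply: (@D4_line_inj F); rewrite -labelE. Qed.

Lemma labelK : cancel label label_line.
Proof.
move=> L; rewrite /label_line; case: L (labelE L) => L SL /= e.
exact/eq_exist/esym.
Qed.

Lemma label_skewE L M : label_skew (label L) (label M) = skew (sval L) (sval M).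
Proof.
rewrite !labelE; apply/idP/idP; [exact: label_skew_skew | exact: skew_label_skew].
Qed.

Lemma mark_subproof L k : (root_point F k (mark_index (label L) k) <= sval L)%VS.
Proof. by rewrite labelE; apply: root_point_on. Qed.

Definition mark L k : points_on (sval L) :=
  exist (fun P : point F => P <= sval L)%VS _ (mark_subproof L k).

Lemma mark_inj L : injective (mark L).
Proof.
move=> k k' e; apply/eqP/negPn/negP => kk'.
have /hasP[h _ /andP[]] := roots_separated (mark_index (label L) k)
  (mark_index (label L) k') kk'.
by rewrite -!(root_point_incident F) (congr1 sval e : root_point _ _ _ = _) => ->.
Qed.

Lemma proj_mark L M N (LM : skew (sval L) (sval M)) (MN : skew (sval M) (sval N))
    k j :
  sends (label L) (label M) (label N) k j ->
  proj_map LM MN (mark L k) = mark N j.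
Proof.
move=> /hasP[h h_in /and3P[hk hM hj]].
have /hasP[i _ hi] := plane_avoids h_in.
apply: (proj_map_plane _ _ (H := PSubspace (@plane_space_dim F _ _ _ hi))) => /=.
- by rewrite root_point_incident.
- by rewrite labelE D4_line_contains.
- by rewrite root_point_incident.
Qed.

(** The induction runs over bare lines, so the membership proofs are quantified afterwards. Only a
    function on colours is obtained here; [phom_perm] gets injectivity from invertibility. *)
Lemma composite_mark (L M : line F) (f : points_on L -> points_on M) :
  composite S f -> forall (SL : S L) (SM : S M), exists r : 'I_3 -> 'I_3,
    forall k, f (mark (exist _ L SL) k) = mark (exist _ M SM) (r k).
Proof.
elim=> [K SK|K L' L'' N KL' L'L'' h SK SL' SL'' _ IH] SL SM.
  (* The two proofs that the same line belongs to the configuration must be identified. *)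
  by exists id => k; rewrite (Prop_irrelevance SL SM).
have [r rE] := IH SL'' SM.
pose K0 : pobj S := exist _ K SL; pose L0 : pobj S := exist _ L' SL'.
pose M0 : pobj S := exist _ L'' SL''.
have /choice[q qE] : forall k, exists j, sends (label K0) (label L0) (label M0) k j.
  move=> k; have /hasP[j _ ?] : has (sends (label K0) (label L0) (label M0) k) colors.
    by apply: sends_exists; rewrite label_skewE.
  by exists j.
by exists (r \o q) => k /=; rewrite -rE (@proj_mark K0 L0 M0 _ _ k _ (qE k)).
Qed.

Lemma phom_perm L M (f : phom L M) :
  exists s, forall k, sval f (mark L k) = mark M (s k).
Proof.
case: L M f => [L SL] [M SM] f.
have [r rE] := composite_mark (svalP f) SL SM.
have [g _ [fK _]] := composite_inv (svalP f).
have r_inj : injective r.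
  move=> k k' e; apply: (@mark_inj (exist _ L SL)).
  by apply: (can_inj fK); rewrite !rE e.
by exists (perm r_inj) => k; rewrite permE.
Qed.

Lemma phom_eq L M (f g : phom L M) :
  (forall k, sval f (mark L k) = sval g (mark L k)) -> f = g.
Proof.
move=> fg; apply/phom_inj/funext.
have neq k k' : k != k' -> mark L k != mark L k'.
  by apply: contra_neq; apply: mark_inj.
by apply: (composite_inj (svalP f) (svalP g)
  (neq 0 1 isT) (neq 0 2 isT) (neq 1 2 isT)).
Qed.

Definition pproj L M N (LM : skew (sval L) (sval M)) (MN : skew (sval M) (sval N)) :
  phom L N :=
  exist _ (proj_map LM MN) (Composite_cons LM MN (svalP L) (svalP M) (svalP N)
    (Composite_nil (svalP N))).

Lemma phom_inhabited L N : inhabited (phom L N).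
Proof.
have /hasP[m _ /andP[]] := label_skew_common (label L) (label N).
by rewrite -(label_lineK m) !label_skewE => Lm mN; split; exact: (pproj Lm mN).
Qed.

(** * Every permutation of the colours is realized *)

Definition realizes L s :=
  exists f : phom L L, forall k, sval f (mark L k) = mark L (s k).

Lemma realizesM L s t : realizes L s -> realizes L t -> realizes L (s * t)%g.
Proof.
(* In [s * t] the left factor acts first, so [g] is composed after [f]. *)
move=> [f fE] [g gE]; exists (pcomp g f) => k.
by rewrite permM /= fE gE.
Qed.

Lemma realizes1 L : realizes L 1%g.
Proof. by exists (pid L) => k; rewrite perm1. Qed.

Lemma realizes_loop (l m n o u w : 'I_4 * 'I_4) s :
  label_skew l m -> label_skew m n -> label_skew n o -> label_skew o u ->
  label_skew u w -> label_skew w l ->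
  (forall k, exists k1 k2,
     [/\ sends l m n k k1, sends n o u k1 k2 & sends u w l k2 (s k)]) ->
  realizes (label_line l) s.
Proof.
rewrite -[l]label_lineK -[m]label_lineK -[n]label_lineK -[o]label_lineK.
rewrite -[u]label_lineK -[w]label_lineK labelK !label_skewE.
move=> lm mn no ou uw wl sE.
exists (pcomp (pproj uw wl) (pcomp (pproj no ou) (pproj lm mn))) => k.
have [k1 [k2 [e1 e2 e3]]] := sE k.
by rewrite /= (proj_mark _ _ e1) (proj_mark _ _ e2) (proj_mark _ _ e3).
Qed.

Lemma realizes_tperm (i j : 'I_3) :
  realizes (label_line (@Ordinal 4 0 isT, @Ordinal 4 0 isT)) (tperm i j).
Proof.
have [<-|ij] := eqVneq i j; first by rewrite tperm1; apply: realizes1.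
have [m [n [o [u [w [/and3P[lm mn no] /and3P[ou uw wl] sE]]]]]] :=
  transposition_loop ij.
apply: (realizes_loop lm mn no ou uw wl) => k.
by rewrite permE /=; apply: sE.
Qed.

(** Transpositions generate the group at the base line [B]; a morphism from [L] to [B] transports
    the result by conjugation. *)
Lemma realizes_all L s : realizes L s.
Proof.
pose B : pobj S := label_line (@Ordinal 4 0 isT, @Ordinal 4 0 isT).
have realB t : realizes B t.
  have [ts -> _] := prod_tpermP t.
  apply: big_ind => [||x _]; first exact: realizes1.
    exact: realizesM.
  exact: realizes_tperm.
have [f] := phom_inhabited L B; have [r rE] := phom_perm f.
(* If [f] acts on colours by [r], conjugating this [g] back along [f] yields exactly [s]. *)
have [g gE] := realB (r^-1 * s * r)%g.
exists (pcomp (pinv f) (pcomp g f)) => k /=.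
rewrite rE gE !permM permK -rE.
exact: (svalP (pinv_sig f)).1.
Qed.

(* Composition of maps and the product of permutations go in opposite orders,
   hence the inverse. *)
Lemma D4_gaut_iso (L : gobj (projection_groupoid S)) : group_iso (gaut L) 'S_3.
Proof.
pose perm_of (f : phom L L) := sval (cid (phom_perm f)).
have perm_ofE f k : sval f (mark L k) = mark L (perm_of f k).
  by rewrite /perm_of; case: cid.
apply: (@group_iso_bij (gaut L) _ (fun f => (perm_of f)^-1)%g).
  move=> f g; rewrite -invMg; congr (_^-1)%g; apply/permP => k.
  by apply: (@mark_inj L); rewrite permM -!perm_ofE.
(* The inverse map picks a realization of each permutation; [phom_eq] shows that the pick is
   forced. *)
have /choice[inv invE] s : exists f : phom L L, forall k,
    sval f (mark L k) = mark L ((s^-1)%g k) by apply: realizes_all.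
exists inv => [f|s] /=.
  by apply: phom_eq => k; rewrite invE invgK perm_ofE.
rewrite -[RHS]invgK; congr (_^-1)%g; apply/permP => k.
by apply: (@mark_inj L); rewrite -perm_ofE invE.
Qed.

End D4Groupoid.

Theorem theorem1 (R : realType) :
  has_group (projection_groupoid (@D4_lines R[i])) 'S_3.
Proof. exact/has_group_iso/D4_gaut_iso. Qed.
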